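(* Let $p=(p_1,\dots,p_k)$ be a $k$-vector with nonnegative entries that sum to one. Let $X_1,X_2,\dots$ be independent samples from the multinomial$(1,p)$ distribution. For each $n\ge 1$ and $1\le j\le k$, let $N_j=n\bar X_j=\sum_{i=1}^n X_{ij}$ be the number of successes in the $j$th category for trials $1,\dots,n$. Then the Pearson chi-square statistic $$\chi^2=\sum_{j=1}^{k}\frac{(N_j-np_j)^2}{np_j}$$ converges in distribution, as $n\to\infty$, to the chi-square distribution with $k-1$ degrees of freedom.
   Context: A random vector $X_i=(X_{i1},\dots,X_{ik})$ has the multinomial$(1,p)$ distribution if it consists of exactly $k-1$ zeros and a single one, the one being in the component of the ''success'' category at trial $i$, and $P(X_{ij}=1)=1-P(X_{ij}=0)=p_j$ for all $1\le j\le k$. Here $\bar X_j=\frac1n\sum_{i=1}^n X_{ij}$. The chi-square distribution with $m$ degrees of freedom is the law of $Z_1^2+\dots+Z_m^2$, where $Z_1,\dots,Z_m$ are independent standard normal random variables.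
   Formalization: All entries of p are assumed nonzero (hence positive): if some p_j = 0, the corresponding term of the Pearson statistic is 0/0 and undefined, and with the convention 0/0 = 0 the limit would not have k−1 degrees of freedom. *)

(* Defs.v *)
From HB Require Import structures.
From mathcomp Require Import all_boot all_order all_algebra.
From mathcomp Require Import all_classical all_reals all_analysis.
From mathcomp Require Import measurable_realfun.

Set Implicit Arguments.
Unset Strict Implicit.
Unset Printing Implicit Defensive.

Import Order.TTheory GRing.Theory Num.Theory.
Import numFieldNormedType.Exports.

Local Open Scope classical_set_scope.
Local Open Scope ring_scope.

(* {RV P >-> T'} does not depend on P up to conversion, so the probability is an
   explicit argument of the predicates below. *)

(* Mutual independence: the product rule over every finite subfamily. *)
Definition independent_RVs d d' (T : measurableType d) (T' : measurableType d')
    (R : realType) (P : probability T R) (I : choiceType)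
    (X : I -> {RV P >-> T'}) : Prop :=
  forall (J : seq I) (B : I -> set T'), uniq J -> (forall i, measurable (B i)) ->
    P (\bigcap_(i in [set` J]) (X i @^-1` B i)) =
    (\prod_(i <- J) P (X i @^-1` B i))%E.
Arguments independent_RVs {d d' T T' R} P {I} X.

Definition cvg_in_distribution d (T : measurableType d) (R : realType)
    (P : probability T R) (Y : nat -> {RV P >-> R})
    (mu : probability R R) : Prop :=
  let F := fun x : R => mu `]-oo, x]%classic in
  forall x : R, {for x, continuous F} -> cdf (Y n) x @[n --> \oo] --> F x.
Arguments cvg_in_distribution {d T R} P Y mu.

(* Since this describes the law of X, the shape of X is required almost surely. *)
Definition multinomial1 d (T : measurableType d) (R : realType)
    (P : probability T R) (k : nat) (p : 'I_k -> R)
    (X : {RV P >-> k.-tuple R}) : Prop :=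
  {ae P, forall w, exists j : 'I_k,
     tnth (X w) j = 1 /\ forall l, l != j -> tnth (X w) l = 0} /\
  forall j : 'I_k,
    P [set w | tnth (X w) j = 1] = (p j)%:E /\
    (1 - P [set w | tnth (X w) j = 0%R])%E = (p j)%:E.
Arguments multinomial1 {d T R} P {k} p X.

Section pearson.
Context d (T : measurableType d) (R : realType) (P : probability T R) (k : nat).
Implicit Type X : nat -> {RV P >-> k.-tuple R}.

(* Trials are numbered from 0: the first n trials are X 0, ..., X n.-1. *)
Definition successes X (n : nat) (j : 'I_k) (w : T) : R :=
  \sum_(i < n) tnth (X i w) j.

Definition pearson_chi2 (p : 'I_k -> R) X (n : nat) (w : T) : R :=
  \sum_(j < k) (successes X n j w - n%:R * p j) ^+ 2 / (n%:R * p j).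

Lemma measurable_successes X n j : measurable_fun setT (successes X n j).
Proof.
apply: measurable_sum => i.
by apply: (measurableT_comp (measurable_tnth j)).
Qed.

Lemma measurable_pearson_chi2 p X n : measurable_fun setT (pearson_chi2 p X n).
Proof.
apply: measurable_sum => j; apply: measurable_funM => //.
apply: measurable_funX; apply: measurable_funB => //.
exact: measurable_successes.
Qed.

HB.instance Definition _ p X n := @isMeasurableFun.Build _ _ _ _
  (pearson_chi2 p X n) (measurable_pearson_chi2 p X n).

End pearson.

Section iid.
Context d (T : measurableType d) (R : realType) (P : probability T R).

Definition tcons n (x : T * n.-tuple T) : n.+1.-tuple T := [tuple of x.1 :: x.2].

Lemma measurable_tcons n : measurable_fun setT (@tcons n).
Proof. exact: measurable_cons. Qed.

HB.instance Definition _ n := @isMeasurableFun.Build _ _ _ _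
  (@tcons n) (@measurable_tcons n).

(* The n-fold product of P, i.e. the joint law of n independent variables each
   of law P; see iid_coord_distribution and iid_coord_independent. *)
Fixpoint iid_prob (n : nat) : probability (n.-tuple T) R :=
  match n with
  | 0 => \d_([tuple] : 0.-tuple T)
  | m.+1 => distribution (P \x iid_prob m)%E (@tcons m)
  end.

Definition coord n (i : 'I_n) (t : n.-tuple T) : T := tnth t i.

HB.instance Definition _ n i := @isMeasurableFun.Build _ _ _ _
  (@coord n i) (measurable_tnth i).

Lemma iid_probE n (B : 'I_n -> set T) : (forall i, measurable (B i)) ->
  iid_prob n [set t | forall i, B i (coord i t)] = (\prod_(i < n) P (B i))%E.
Proof.
elim: n B => [|n IH] B mB.
  rewrite big_ord0 /= diracE mem_set//= => -[].
  by case.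
rewrite big_ord_recl -IH // -product_measure1E //; last first.
  rewrite (_ : [set _ | _] =
      \bigcap_(i in [set: 'I_n]) (coord i @^-1` B (lift ord0 i))).
    apply: fin_bigcap_measurable => // i _; rewrite -[X in measurable X]setTI.
    exact: (measurable_tnth i).
  by apply/seteqP; split => [t h i _|t h i]; exact: h.
rewrite /= /distribution /pushforward; congr (_ _).
apply/seteqP; split => [[x t]/= h|[x t] /= [h1 h2] i].
  by split => [|i]; [have := h ord0|have := h (lift ord0 i); rewrite /coord tnthS].
case: (unliftP ord0 i) => [j ->|->//].
by rewrite /coord tnthS; exact: h2.
Qed.

Lemma iid_coord_box n (J : seq 'I_n) (B : 'I_n -> set T) :
  uniq J -> (forall i, measurable (B i)) ->
  iid_prob n (\bigcap_(i in [set` J]) (coord i @^-1` B i)) =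
  (\prod_(i <- J) P (B i))%E.
Proof.
move=> uJ mB; pose C i := if i \in J then B i else setT.
have mC i : measurable (C i) by rewrite /C; case: ifP.
rewrite (_ : \bigcap_(i in _) _ = [set t | forall i, C i (coord i t)]).
  rewrite iid_probE // [RHS]big_uniq //= [RHS]big_mkcond /=.
  by apply: eq_bigr => i _; rewrite /C; case: ifP => // _; rewrite probability_setT.
apply/seteqP; split => [t h i|t h i /= iJ].
  by rewrite /C; case: ifP => // iJ; exact: h.
by have := h i; rewrite /C iJ.
Qed.

Lemma iid_coord_distribution n (i : 'I_n) (A : set T) : measurable A ->
  distribution (iid_prob n) (coord i) A = P A.
Proof.
move=> mA; have := @iid_coord_box n [:: i] (fun=> A) isT (fun=> mA).
rewrite big_seq1 => <-; congr (iid_prob n _).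
apply/seteqP; split => [t h j|t h]; last by apply: (h i); rewrite /= inE.
by rewrite /= inE => /eqP ->.
Qed.

Lemma iid_coord_independent n :
  independent_RVs (iid_prob n) (fun i : 'I_n => coord i).
Proof.
move=> J B uJ mB; rewrite iid_coord_box //; apply: eq_bigr => i _.
by rewrite -[LHS](iid_coord_distribution i).
Qed.

End iid.

Section chi_square.
Context (R : realType).

Definition sum_sqr m (z : m.-tuple (measurableTypeR R)) : R := \sum_(i < m) tnth z i ^+ 2.

Lemma measurable_sum_sqr m : measurable_fun setT (@sum_sqr m).
Proof.
apply: measurable_sum => i; apply: measurable_funX; exact: measurable_tnth.
Qed.

HB.instance Definition _ m := @isMeasurableFun.Build _ _ _ _
  (@sum_sqr m) (@measurable_sum_sqr m).

(* The law of Z_1^2 + ... + Z_m^2 for Z_1, ..., Z_m iid standard normal; for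
   m = 0 this is the point mass at 0. *)
Definition chi_square (m : nat) : probability R R :=
  distribution (iid_prob (normal_prob (0 : R) 1) m) (@sum_sqr m).

End chi_square.

(* Main.v *)
Require Import Defs.
From mathcomp Require Import all_boot all_order all_algebra.
From mathcomp Require Import all_classical all_reals all_analysis.
From mathcomp Require Import measurable_realfun.
From mathcomp Require Import ring lra.
Set Implicit Arguments.
Unset Strict Implicit.
Unset Printing Implicit Defensive.
Import Order.TTheory GRing.Theory Num.Theory.
Import numFieldNormedType.Exports.
Local Open Scope classical_set_scope.
Local Open Scope ring_scope.

(* No central limit theorem is needed: the Laplace transform of the statistic
   solves a discrete heat equation. Let m = k - 1. For a Gaussian in R^m the
   function
     u(s, q) = (1 + 2 l s)^(-m/2) exp(- l q / (1 + 2 l s)),  q = |v|^2,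
   is the heat flow started at exp(- l |v|^2). Let Q_i be the Pearson statistic
   of the first i trials out of n, scaled by n. Conditionally on the first i
   trials, Q_(i+1) = Q_i + a_j / sqrt n + b_j / n with probability p_j, where the
   first two moments of the increment are those of a Gaussian step; hence
   E u(1 - i/n, Q_i) changes by O(n^(-3/2)) at each step, uniformly in Q_i.
   Summing over i <= n, E exp(- l Q_n) tends to u(1, 0) = (1 + 2 l)^(-m/2), the
   Laplace transform of chi-square. Convergence for integer l means convergence of
   all moments of exp(- Q_n) in [0, 1], and Bernstein polynomials turn this into
   convergence of the distribution functions. *)

(** * One-step estimates *)

Section expR_bounds.
Context {R : realType}.
Implicit Types x y : R.

(** Applying 1 + y <= exp y at y = x and at y = - x gives 0 <= exp x - 1 - x <= x (exp x - 1). For x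
    >= 0 the factor exp x - 1 is at most x exp x; for x < 0 the product is at most x ^ 2. *)
Lemma expR_taylor1 x : `|expR x - 1 - x| <= x ^+ 2 * expR `|x|.
Proof.
have h1 := expR_ge1Dx x; have h2 := expR_ge1Dx (- x).
have e0 := expR_gt0 x; have ee : expR x * expR (- x) = 1 by rewrite expRxMexpNx_1.
have h3 : expR x - 1 <= x * expR x by nra.
rewrite ger0_norm; last by lra.
case: (leP 0 x) => x0.
  rewrite ger0_norm // expr2 -mulrA.
  have : x * (expR x - 1) <= x * (x * expR x) by rewrite ler_wpM2l.
  by lra.
rewrite ltr0_norm //.
have h4 : 1 <= expR (- x) by rewrite -expR0 ler_expR; lra.
have h5 : x ^+ 2 <= x ^+ 2 * expR (- x) by rewrite ler_peMr ?sqr_ge0.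
have : x * (expR x - 1 - x) <= 0 by nra.
by nra.
Qed.

(** By the mean value theorem the remainder at x is x times its derivative at a point between 0 and
    x, and that derivative is the first-order remainder of [expR_taylor1]. *)
Lemma expR_taylor2 x :
  `|expR x - (1 + x + x ^+ 2 / 2)| <= `|x| ^+ 3 * expR `|x|.
Proof.
pose f (y : R) := expR y - (1 + y + y ^+ 2 / 2).
pose f' (y : R) := expR y - 1 - y.
have df y : is_derive y 1 (f : R -> R) (f' y).
  rewrite /f; apply: is_derive_eq; rewrite /f' /GRing.scale /=.
  by field.
have f0 : f 0 = 0 by rewrite /f expR0; ring.
have cf A : {within A, continuous f}.
  apply: continuous_subspaceT => y.
  by apply/differentiable_continuous/derivable1_diffP; have [] := df y.
have bound c : `|c| <= `|x| -> `|f' c| <= `|x| ^+ 2 * expR `|x|.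
  move=> cx; apply: (le_trans (expR_taylor1 c)).
  apply: ler_pM; rewrite ?sqr_ge0 ?expR_ge0 ?ler_expR //.
  by rewrite -[leLHS]real_normK ?num_real // lerXn2r ?nnegrE.
rewrite [leRHS](_ : _ = `|x| ^+ 2 * expR `|x| * `|x|); last by ring.
case: (leP 0 x) => x0.
- have [c cI] := MVT_segment x0 (fun y _ => df y) (cf _).
  rewrite f0 !subr0 -/(f x) => ->; rewrite normrM ler_wpM2r //.
  move: cI; rewrite in_itv /= => /andP[c0 cx]; apply: bound.
  by rewrite !ger0_norm.
- have [c cI] := MVT_segment (ltW x0) (fun y _ => df y) (cf _).
  rewrite f0 !sub0r mulrN => /oppr_inj; rewrite /f => ->.
  rewrite normrM ler_wpM2r //.
  move: cI; rewrite in_itv /= => /andP[c0 cx]; apply: bound.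
  by rewrite !ler0_norm ?lerN2 // ltW.
Qed.

Lemma ln1D_bound x : 0 <= x -> x - x ^+ 2 <= ln (1 + x) <= x.
Proof.
move=> x0; apply/andP; split; last by apply: le_ln1Dx; lra.
have p : 0 < 1 + x by lra.
have h : ln (1 + x)^-1 <= (1 + x)^-1 - 1.
  have -> : ln (1 + x)^-1 = ln (1 + ((1 + x)^-1 - 1)) by congr ln; ring.
  apply: le_ln1Dx; have : 0 < (1 + x)^-1 by rewrite invr_gt0.
  by lra.
move: h; rewrite lnV ?posrE // => h.
have : x - x ^+ 2 <= 1 - (1 + x)^-1; last by lra.
have h1 : (1 + x)^-1 * (1 + x) = 1 by rewrite mulVf // gt_eqF.
have : 0 < (1 + x)^-1 by rewrite invr_gt0.
set i := (1 + x)^-1 in h1 *; nra.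
Qed.

Lemma ler_sqr_expR x : 0 <= x -> x ^+ 2 <= 2 * expR x.
Proof. by move=> x0; have := expR_ge1Dxn 1 x0; rewrite /= (_ : 2`! = 2%N) //; lra. Qed.

Lemma ler_cube_expR x : 0 <= x -> x ^+ 3 <= 6 * expR x.
Proof. by move=> x0; have := expR_ge1Dxn 2 x0; rewrite /= (_ : 3`! = 6%N) //; lra. Qed.

End expR_bounds.

Section one_step.
Context {R : realType}.

(** In the application r is the square root of the current statistic and h = n^(-1/2). The jump
    coefficient a may grow like r, so the Taylor remainder is only bounded by a multiple of exp (2 M
    r); the factor exp (- c r ^ 2) absorbs this, and one K serves all r. *)
Lemma expR_step_bound (c0 l D : R) : 0 < c0 -> 0 <= l -> 0 <= D ->
  exists2 K, 0 <= K & forall c r a b h : R, c0 <= c <= l -> 0 <= r ->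
    `|a| <= D * r -> 0 <= b <= D -> 0 <= h <= 1 ->
  `|expR (- (c * (r ^+ 2 + (a * h + b * h ^+ 2)))) - expR (- (c * r ^+ 2)) *
     (1 - c * (a * h + b * h ^+ 2) + (c * a * h) ^+ 2 / 2)| <= K * h ^+ 3.
Proof.
move=> c0gt0 l0 D0; pose M := l * D.
have M0 : 0 <= M by rewrite mulr_ge0.
exists ((6 + M) * expR (2 * M + M ^+ 2 / c0)).
  by rewrite mulr_ge0 ?expR_ge0 //; lra.
move=> c r a b h /andP[cc0 cl] r0 aD /andP[b0 bD] /andP[h0 h1].
have cgt0 : 0 < c by exact: lt_le_trans cc0.
pose y := - (c * (a * h + b * h ^+ 2)).
have hh : h ^+ 2 <= h by rewrite expr2 ler_piMl.
have cD : c * D <= M by rewrite ler_wpM2r.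
have cD0 : 0 <= c * D by rewrite mulr_ge0 // ltW.
have y1 : `|y| <= M * (r + 1) * h.
  rewrite normrN normrM (gtr0_norm cgt0).
  apply: (@le_trans _ _ (c * (D * r * h + D * h))).
    rewrite ler_wpM2l ?(ltW cgt0) // (le_trans (ler_normD _ _)) //.
    rewrite (normrM a) (normrM b) (ger0_norm h0) (ger0_norm b0).
    rewrite (ger0_norm (sqr_ge0 h)) lerD //.
      by rewrite ler_wpM2r.
    by rewrite ler_pM // sqr_ge0.
  rewrite [leLHS](_ : _ = (c * D) * ((r + 1) * h)); last by ring.
  by rewrite -[leRHS]mulrA ler_wpM2r // mulr_ge0 // addr_ge0.
have My0 : 0 <= M * (r + 1) by rewrite mulr_ge0 // addr_ge0.
have y2 : `|y| <= M * (r + 1) by rewrite (le_trans y1) // ler_piMr.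
have E0 : expR (- (c * r ^+ 2)) <= expR (- (c0 * r ^+ 2)).
  by rewrite ler_expR lerN2 ler_wpM2r // sqr_ge0.
rewrite mulrDr opprD -/y expRD -mulrBr normrM (ger0_norm (expR_ge0 _)).
(* Squaring y produces, besides (c a h) ^ 2, terms in a b h ^ 3 and b ^ 2 h ^ 4, which already have
   the order of the error. *)
have -> : expR y - (1 - c * (a * h + b * h ^+ 2) + (c * a * h) ^+ 2 / 2) =
   (expR y - (1 + y + y ^+ 2 / 2)) +
   c ^+ 2 * (a * b * h ^+ 3 + b ^+ 2 * h ^+ 4 / 2).
  by rewrite /y; field.
have h3 : 0 <= h ^+ 3 by rewrite exprn_ge0.
have t1 : `|expR y - (1 + y + y ^+ 2 / 2)| <=
    6 * expR (2 * (M * (r + 1))) * h ^+ 3.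
  apply: (le_trans (expR_taylor2 y)).
  apply: (@le_trans _ _ ((M * (r + 1)) ^+ 3 * h ^+ 3 * expR (M * (r + 1)))).
    rewrite ler_pM ?exprn_ge0 ?expR_ge0 ?ler_expR //.
    by rewrite -exprMn lerXn2r ?nnegrE // mulr_ge0.
  rewrite mulrAC ler_wpM2r // (_ : 2 * _ = M * (r + 1) + M * (r + 1)); last by ring.
  by rewrite expRD mulrA ler_wpM2r ?expR_ge0 // ler_cube_expR.
have t2 : `|c ^+ 2 * (a * b * h ^+ 3 + b ^+ 2 * h ^+ 4 / 2)| <=
    M * expR (2 * (M * (r + 1))) * h ^+ 3.
  rewrite normrM (ger0_norm (sqr_ge0 _)).
  apply: (@le_trans _ _ (c ^+ 2 * (D * r * D * h ^+ 3 + D ^+ 2 * h ^+ 3))).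
    rewrite ler_wpM2l ?sqr_ge0 // (le_trans (ler_normD _ _)) // lerD //.
      by rewrite (normrM _ (h ^+ 3)) (normrM a) (ger0_norm h3) (ger0_norm b0)
        ler_wpM2r // ler_pM.
    have h4 : h ^+ 4 <= h ^+ 3 by rewrite (exprS _ 3) ler_piMl.
    have h40 : 0 <= h ^+ 4 by rewrite exprn_ge0.
    rewrite ger0_norm; last by rewrite !mulr_ge0 ?sqr_ge0 // invr_ge0.
    rewrite -mulrA ler_pM ?sqr_ge0 ?lerXn2r ?nnegrE //; last by lra.
    by rewrite mulr_ge0 // invr_ge0.
  rewrite [leLHS](_ : _ = (c * D) * ((c * D) * (r + 1)) * h ^+ 3); last by ring.
  rewrite ler_wpM2r // ler_pM ?mulr_ge0 ?addr_ge0 ?(ltW cgt0) //.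
  apply: (@le_trans _ _ (M * (r + 1))).
    by rewrite ler_wpM2r // addr_ge0.
  by apply: le_trans (expR_ge1Dx _); lra.
apply: (@le_trans _ _ (expR (- (c0 * r ^+ 2)) *
    ((6 + M) * expR (2 * (M * (r + 1))) * h ^+ 3))).
  rewrite ler_pM ?expR_ge0 // (le_trans (ler_normD _ _)) //.
  by rewrite [in leRHS]mulrDl mulrDl lerD.
rewrite [leLHS](_ : _ = (6 + M) *
  (expR (- (c0 * r ^+ 2)) * expR (2 * (M * (r + 1)))) * h ^+ 3); last by ring.
have M6 : 0 <= 6 + M by lra.
rewrite ler_wpM2r // ler_wpM2l // -expRD ler_expR.
(* Completing the square in r; this is the source of M ^ 2 / c0 in the constant. *)
have : 2 * M * r <= c0 * r ^+ 2 + M ^+ 2 / c0; last by lra.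
rewrite -subr_ge0 [leRHS](_ : _ = (c0 * r - M) ^+ 2 / c0).
  by rewrite mulr_ge0 ?sqr_ge0 // invr_ge0 ltW.
by field; rewrite gt_eqF.
Qed.

(** First-order expansion of the heat flow in time: half the Laplacian of exp (- c |v| ^ 2) in
    dimension m is (2 c ^ 2 q - c m) exp (- c q). The flow is written as exp (- c q) exp z with z of
    order (q + 1) t, and exp z is expanded. *)
Lemma heat_step_bound (c0 l m : R) : 0 < c0 -> 0 <= l -> 0 <= m ->
  exists2 K, 0 <= K & forall c q t : R, c0 <= c <= l -> 0 <= q -> 0 <= t <= 1 ->
  `|expR (- (m / 2 * ln (1 + 2 * c * t))) * expR (- (c / (1 + 2 * c * t) * q)) -
    expR (- (c * q)) * (1 - c * m * t + 2 * c ^+ 2 * q * t)| <= K * t ^+ 2.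
Proof.
(* [c1] is a lower bound for the decay rate c / (1 + 2 c t) that is left in q. Powers of q are
   expressed in u = c1 q and absorbed by exp (- u). *)
move=> c0gt0 l0 m0; pose c1 := c0 / (1 + 2 * l).
have l1 : 0 < 1 + 2 * l by lra.
have c1gt0 : 0 < c1 by rewrite divr_gt0.
pose A := 2 * l ^+ 2 / c1 + m * l.
pose B := 4 * l ^+ 3 / c1 + 2 * m * l ^+ 2.
have l2 : 0 <= l ^+ 2 by rewrite sqr_ge0.
have l3 : 0 <= l ^+ 3 by rewrite exprn_ge0.
have ml0 : 0 <= m * l by rewrite mulr_ge0.
have ml2 : 0 <= m * l ^+ 2 by rewrite mulr_ge0.
have A0 : 0 <= A by rewrite addr_ge0 // divr_ge0 ?(ltW c1gt0) // mulr_ge0.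
have B0 : 0 <= B.
  have : 0 <= 4 * l ^+ 3 / c1 by rewrite divr_ge0 ?(ltW c1gt0) ?mulr_ge0.
  by rewrite /B; lra.
exists (2 * A ^+ 2 * expR (1 + m * l) + B * expR 1).
  by rewrite addr_ge0 // !mulr_ge0 ?expR_ge0 ?sqr_ge0.
move=> c q t /andP[cc0 cl] q0 /andP[t0 t1].
have cgt0 : 0 < c by exact: lt_le_trans cc0.
set s := 2 * c * t; have s0 : 0 <= s by rewrite !mulr_ge0 // ltW.
have s1 : 0 < 1 + s by lra.
have ct : c * t <= l * t by rewrite ler_wpM2r.
have ct0 : 0 <= c * t by rewrite mulr_ge0 // ltW.
have cll : c ^+ 2 <= l ^+ 2 by rewrite lerXn2r ?nnegrE // ltW.
have clll : c ^+ 3 <= l ^+ 3 by rewrite lerXn2r ?nnegrE // ltW.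
have sl : s <= 2 * l by rewrite /s; nra.
pose w := s / (1 + s).
have w0 : 0 <= w by rewrite divr_ge0 // ltW.
have ww : w = 1 - (1 + s)^-1 by rewrite /w; field; rewrite gt_eqF.
have ws : s - s ^+ 2 <= w <= s.
  rewrite -subr_ge0 (_ : w - _ = s ^+ 3 / (1 + s)); last first.
    by rewrite /w; field; rewrite gt_eqF.
  rewrite divr_ge0 ?exprn_ge0 ?(ltW s1) //=.
  by rewrite ler_pdivrMr // ler_peMr //; lra.
case/andP: ws => ws1 ws2.
have /andP[ln1 ln2] := ln1D_bound s0.
pose z := c * q * w - m / 2 * ln (1 + s).
have cq0 : 0 <= c * q by rewrite mulr_ge0 // ltW.
have lns0 : 0 <= ln (1 + s) by rewrite ln_ge0 //; lra.
have mln0 : 0 <= m / 2 * ln (1 + s) by rewrite !mulr_ge0.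
have mln1 : m / 2 * ln (1 + s) <= m * (c * t).
  apply: (@le_trans _ _ (m / 2 * s)); first by rewrite ler_wpM2l // divr_ge0.
  by rewrite /s; lra.
have mln2 : m * (c * t) <= m * l * t by rewrite -mulrA ler_wpM2l.
have mln3 : m * l * t <= m * l by rewrite ler_piMr.
have z1 : `|z| <= c * q * w + m * l.
  have : 0 <= c * q * w by rewrite mulr_ge0.
  by rewrite /z ler_norml => ?; apply/andP; split; lra.
pose u := c1 * q.
have c1i : 0 <= c1^-1 by rewrite invr_ge0 ltW.
have u0 : 0 <= u by rewrite mulr_ge0 // ltW.
have qu : q = u / c1 by rewrite /u mulrC mulKf // gt_eqF.
have z2 : `|z| <= A * (u + 1) * t.
  have : c * q * w <= 2 * l ^+ 2 * q * t.
    apply: (@le_trans _ _ (c * q * s)); first by rewrite ler_wpM2l.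
    rewrite [leLHS](_ : _ = 2 * c ^+ 2 * q * t); last by rewrite /s; ring.
    by rewrite !ler_wpM2r // ler_wpM2l.
  have -> : A * (u + 1) * t =
      2 * l ^+ 2 * q * t + m * l * t + (2 * l ^+ 2 / c1 + m * l * u) * t.
    by rewrite /A qu /u; field; rewrite gt_eqF.
  have : 0 <= (2 * l ^+ 2 / c1 + m * l * u) * t.
    by rewrite mulr_ge0 // addr_ge0 // mulr_ge0 // mulr_ge0.
  have : 0 <= c * q * w by rewrite mulr_ge0.
  by rewrite /z ler_norml => *; apply/andP; split; lra.
have z3 : `|z - (2 * c ^+ 2 * q * t - c * m * t)| <= B * (u + 1) * t ^+ 2.
  have -> : z - (2 * c ^+ 2 * q * t - c * m * t) =
      - (c * q * (s - w)) + m / 2 * (s - ln (1 + s)).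
    by rewrite /z /s; field.
  have sst : s ^+ 2 = 4 * c ^+ 2 * t ^+ 2 by rewrite /s; ring.
  have tt : 0 <= t ^+ 2 by rewrite sqr_ge0.
  have e1 : 0 <= c * q * (s - w) by rewrite mulr_ge0 // subr_ge0.
  have e2 : c * q * (s - w) <= 4 * l ^+ 3 * q * t ^+ 2.
    apply: (@le_trans _ _ (c * q * s ^+ 2)); first by rewrite ler_wpM2l //; lra.
    rewrite [leLHS](_ : _ = 4 * c ^+ 3 * q * t ^+ 2); last by rewrite sst; ring.
    by rewrite !ler_wpM2r // ler_wpM2l.
  have e3 : 0 <= m / 2 * (s - ln (1 + s)) by rewrite !mulr_ge0 ?invr_ge0 // subr_ge0.
  have e4 : m / 2 * (s - ln (1 + s)) <= 2 * m * l ^+ 2 * t ^+ 2.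
    apply: (@le_trans _ _ (m / 2 * s ^+ 2)).
      by rewrite ler_wpM2l ?divr_ge0 //; lra.
    rewrite [leLHS](_ : _ = 2 * m * c ^+ 2 * t ^+ 2); last by rewrite sst; field.
    by rewrite !ler_wpM2r // ler_wpM2l // mulr_ge0.
  have -> : B * (u + 1) * t ^+ 2 = 4 * l ^+ 3 * q * t ^+ 2 +
      2 * m * l ^+ 2 * t ^+ 2 + (4 * l ^+ 3 / c1 + 2 * m * l ^+ 2 * u) * t ^+ 2.
    by rewrite /B qu /u; field; rewrite gt_eqF.
  have : 0 <= (4 * l ^+ 3 / c1 + 2 * m * l ^+ 2 * u) * t ^+ 2.
    rewrite mulr_ge0 // addr_ge0 //; first by rewrite mulr_ge0 // mulr_ge0.
    by rewrite mulr_ge0 // -mulrA mulr_ge0.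
  by rewrite ler_norml => *; apply/andP; split; lra.
(* Since 1 - w = (1 + s)^-1 >= (1 + 2 l)^-1, the growth c q w in z consumes only part of the decay
   exp (- c q). *)
have E1 : expR (- (c * q)) * expR `|z| <= expR (m * l) * expR (- u).
  rewrite -!expRD ler_expR.
  have : c * q * (1 - w) >= u; last by lra.
  rewrite ww opprB addrC subrK /u /c1 mulrAC.
  apply: ler_pM => //; first by rewrite mulr_ge0 // ltW.
  - by rewrite invr_ge0 ltW.
  - by rewrite ler_wpM2r.
  - by rewrite lef_pV2 ?posrE //; lra.
have E2 : expR (- (c * q)) <= expR (- u).
  rewrite ler_expR lerN2 ler_wpM2r // (le_trans _ cc0) //.
  by rewrite ler_pdivrMr // ler_peMr // ?(ltW c0gt0); lra.
have -> : expR (- (m / 2 * ln (1 + s))) * expR (- (c / (1 + s) * q)) =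
    expR (- (c * q)) * expR z.
  rewrite -!expRD; congr expR; rewrite /z /w.
  by field; rewrite gt_eqF.
rewrite -mulrBr normrM (ger0_norm (expR_ge0 _)).
have -> : expR z - (1 - c * m * t + 2 * c ^+ 2 * q * t) =
  (expR z - 1 - z) + (z - (2 * c ^+ 2 * q * t - c * m * t)) by ring.
have zz : z ^+ 2 <= A ^+ 2 * (2 * (expR u * expR 1)) * t ^+ 2.
  rewrite -[leLHS]real_normK ?num_real //.
  apply: (@le_trans _ _ ((A * (u + 1) * t) ^+ 2)).
    by rewrite lerXn2r ?nnegrE // !mulr_ge0 // addr_ge0.
  rewrite !exprMn ler_wpM2r ?sqr_ge0 // ler_wpM2l ?sqr_ge0 // -expRD.
  by rewrite ler_sqr_expR // addr_ge0.
have uu : u + 1 <= expR u * expR 1 by rewrite -expRD; have := expR_ge1Dx (u + 1); lra.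
have eu : expR u * expR (- u) = 1 by rewrite expRxMexpNx_1.
apply: (@le_trans _ _ (expR (- (c * q)) * (z ^+ 2 * expR `|z| + B * (u + 1) * t ^+ 2))).
  rewrite ler_wpM2l ?expR_ge0 // (le_trans (ler_normD _ _)) // lerD //.
  exact: expR_taylor1.
rewrite [leLHS]mulrDr [leRHS]mulrDl lerD //.
  apply: (@le_trans _ _ ((A ^+ 2 * (2 * (expR u * expR 1)) * t ^+ 2) *
      (expR (m * l) * expR (- u)))).
    rewrite mulrCA ler_pM ?sqr_ge0 // mulr_ge0 ?expR_ge0 //.
  rewrite [leLHS](_ : _ = 2 * A ^+ 2 * (expR 1 * expR (m * l)) * t ^+ 2 *
    (expR u * expR (- u))); last by ring.
  by rewrite eu mulr1 -expRD.
apply: (@le_trans _ _ (expR (- u) * (B * (expR u * expR 1) * t ^+ 2))).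
  rewrite ler_pM ?expR_ge0 //.
    by rewrite mulr_ge0 ?sqr_ge0 // mulr_ge0 // addr_ge0.
  by rewrite ler_wpM2r ?sqr_ge0 // ler_wpM2l.
rewrite [leLHS](_ : _ = B * expR 1 * t ^+ 2 * (expR u * expR (- u))); last by ring.
by rewrite eu mulr1.
Qed.

End one_step.

(** * Laplace transform of the Pearson statistic *)

Section word_mean.
Context {R : realType} {k : nat} (p : 'I_k -> R).
Implicit Types (f g : seq 'I_k -> R) (w : seq 'I_k).

(* The mean of f over words of n independent letters of law p. *)
Fixpoint word_mean n f : R :=
  if n is m.+1 then word_mean m (fun w => \sum_j p j * f (rcons w j)) else f [::].

Lemma eq_word_mean n f g : (forall w, size w = n -> f w = g w) ->
  word_mean n f = word_mean n g.
Proof.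
elim: n f g => [|n IH] f g fg /=; first exact: fg.
apply: IH => w wn; apply: eq_bigr => j _.
by rewrite fg // size_rcons wn.
Qed.

Lemma word_mean_linear n a f g :
  word_mean n (fun w => a * f w + g w) = a * word_mean n f + word_mean n g.
Proof.
elim: n f g => [//|n IH] f g /=; rewrite -IH; apply: eq_word_mean => w _.
rewrite mulr_sumr -big_split /=; apply: eq_bigr => j _.
by rewrite mulrDr mulrCA.
Qed.

Lemma word_meanZ n a f : word_mean n (fun w => a * f w) = a * word_mean n f.
Proof.
elim: n f => [//|n IH] f /=; rewrite -IH; apply: eq_word_mean => w _.
by rewrite mulr_sumr; apply: eq_bigr => j _; rewrite mulrCA.
Qed.

Hypothesis p_sum1 : \sum_j p j = 1.

Lemma word_mean_cst n a : word_mean n (fun=> a) = a.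
Proof.
elim: n => [//|n IH] /=; rewrite -[RHS]IH; apply: eq_word_mean => w _.
by rewrite -mulr_suml p_sum1 mul1r.
Qed.

Hypothesis p_gt0 : forall j, 0 < p j.

Lemma le_word_mean n f g : (forall w, size w = n -> f w <= g w) ->
  word_mean n f <= word_mean n g.
Proof.
elim: n f g => [|n IH] f g fg /=; first exact: fg.
apply: IH => w wn; apply: ler_sum => j _.
by rewrite ler_wpM2l ?(ltW (p_gt0 j)) // fg // size_rcons wn.
Qed.

Lemma word_mean_dist n f g e : (forall w, size w = n -> `|f w - g w| <= e) ->
  `|word_mean n f - word_mean n g| <= e.
Proof.
move=> fge.
have -> : word_mean n f - word_mean n g = word_mean n (fun w => f w - g w).
  rewrite addrC -mulN1r -word_mean_linear; apply: eq_word_mean => w _.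
  by rewrite mulN1r addrC.
rewrite ler_norml -[X in - X](word_mean_cst n) -[X in _ && (_ <= X)](word_mean_cst n).
rewrite -mulN1r -word_meanZ.
by apply/andP; split; apply: le_word_mean => w /fge;
  rewrite ler_norml ?mulN1r => /andP[].
Qed.

Definition deviation w (j : 'I_k) : R := (count_mem j w)%:R - (size w)%:R * p j.

(* n is the total number of trials and need not be the length of w *)
Definition pearson_word n w : R :=
  \sum_j deviation w j ^+ 2 / (n%:R * p j).

Lemma pearson_word_ge0 n w : 0 <= pearson_word n w.
Proof.
apply: sumr_ge0 => j _; apply: mulr_ge0; rewrite ?sqr_ge0 //.
by rewrite invr_ge0 mulr_ge0 // ltW.
Qed.

Lemma sum_deviation w : \sum_j deviation w j = 0.
Proof.
rewrite sumrB -mulr_sumr p_sum1 mulr1 -natr_sum.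
suff -> : (\sum_j count_mem j w)%N = size w by rewrite subrr.
elim: w => [|i w IH] /=; first by rewrite big1.
rewrite big_split /= IH (bigD1 i) //= eqxx big1 // => j ji.
by rewrite eq_sym (negbTE ji).
Qed.

Lemma deviation_rcons w j l :
  deviation (rcons w j) l = deviation w l + ((j == l)%:R - p l).
Proof.
rewrite /deviation size_rcons -cats1 count_cat /= addn0 natrD -natr1.
by ring.
Qed.

(** The new letter j moves the deviation of l by (j == l) - p l. The terms not tied to j add up to 1
    / n, because deviations sum to zero and p to one, so only the deviation of j survives. *)
Lemma pearson_word_rcons n w j : pearson_word n (rcons w j) =
  pearson_word n w + (2 * deviation w j / p j + ((p j)^-1 - 1)) / n%:R.
Proof.
have pU l : p l != 0 by rewrite gt_eqF.
(* For n = 0 every quotient is 0, the inverse of 0 being 0. *)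
have [->|n0] := eqVneq n 0%N.
  rewrite /pearson_word invr0 mulr0 addr0.
  by rewrite !big1 // => l _; rewrite mul0r invr0 mulr0.
have nU : n%:R != 0 :> R by rewrite pnatr_eq0.
rewrite /pearson_word.
under eq_bigr => l _.
  rewrite deviation_rcons.
  rewrite (_ : _ / _ = deviation w l ^+ 2 / (n%:R * p l) +
     (n%:R^-1 * ((j == l)%:R * (2 * deviation w l / p l + ((p l)^-1 - 2))) +
     n%:R^-1 * (p l - 2 * deviation w l))); last first.
    by case: (j == l); rewrite ?mulr1n ?mulr0n; field; rewrite nU pU.
  over.
rewrite !big_split /= -!mulr_sumr; congr (_ + _).
rewrite sumrB p_sum1 -mulr_sumr sum_deviation mulr0 subr0 (bigD1 j) //=.
rewrite eqxx big1 => [|l lj]; last by rewrite eq_sym (negbTE lj) mul0r. rewrite mulr1n.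
by field; rewrite nU pU.
Qed.

(** This bounds a jump by a constant times the square root of the statistic, as [expR_step_bound]
    requires. *)
Lemma sqr_deviation_le n w j : deviation w j ^+ 2 / (n%:R * p j) <= pearson_word n w.
Proof.
rewrite /pearson_word (bigD1 j) //= lerDl; apply: sumr_ge0 => l _.
by rewrite mulr_ge0 ?sqr_ge0 // invr_ge0 mulr_ge0 // ltW.
Qed.

Let p_le1 j : p j <= 1.
Proof.
rewrite -p_sum1 (bigD1 j) //= lerDl; apply: sumr_ge0 => l _; exact: ltW.
Qed.

Let m : R := k%:R - 1.

Let m_ge0 : 0 <= m.
Proof.
rewrite subr_ge0 -[1]/(1%:R) ler_nat lt0n; apply/negP => /eqP k0.
have : \sum_j p j = 0 by apply: big1 => -[i ik]; exfalso; rewrite k0 in ik.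
by rewrite p_sum1 => /eqP; rewrite oner_eq0.
Qed.

(** Both terms are compared with the same expansion [M]: the random letter with an error of order
    n^(-3/2), the heat flow over time 1 / n with one of order n^-2. The bound is uniform over an
    interval of c because c changes from step to step. *)
Lemma pearson_word_step (c0 l : R) : 0 < c0 -> 0 <= l ->
  exists2 K, 0 <= K & forall n w (c : R), (0 < n)%N -> c0 <= c <= l ->
  `|\sum_j p j * expR (- (c * pearson_word n (rcons w j))) -
    expR (- (m / 2 * ln (1 + 2 * c / n%:R))) *
    expR (- (c / (1 + 2 * c / n%:R) * pearson_word n w))|
  <= K * (Num.sqrt n%:R)^-1 ^+ 3.
Proof.
move=> c0gt0 l0.
(* [D] dominates b_j <= 1 / p_j and, being at least 1, also gives a_j ^ 2 = (4 / p_j) (deviation_j ^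
   2 / (n p_j)) <= D q <= D ^ 2 q. *)
pose D : R := \sum_j 4 / p j.
have D4 j : 4 / p j <= D.
  rewrite /D (bigD1 j) //= lerDl; apply: sumr_ge0 => i _.
  by rewrite divr_ge0 // ltW.
have D0 : 0 <= D by apply: sumr_ge0 => i _; rewrite divr_ge0 // ltW.
have [K1 K10 H1] := @expR_step_bound R c0 l D c0gt0 l0 D0.
have [K2 K20 H2] := @heat_step_bound R c0 l m c0gt0 l0 m_ge0.
exists (K1 + K2); first exact: addr_ge0.
move=> n w c n0 cI.
set q := pearson_word n w; have q0 : 0 <= q by exact: pearson_word_ge0.
set h := (Num.sqrt n%:R)^-1.
have nR : 0 < n%:R :> R by rewrite ltr0n.
have nU : n%:R != 0 :> R by rewrite gt_eqF.
have sn0 : 0 < Num.sqrt n%:R :> R by rewrite sqrtr_gt0.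
have h0 : 0 < h by rewrite invr_gt0.
have h1 : h <= 1.
  by rewrite invf_le1 // -{1}sqrtr1 ler_wsqrtr // ler1n.
have hh : h ^+ 2 = n%:R^-1 by rewrite exprVn sqr_sqrtr // ltW.
have hU : h != 0 by rewrite gt_eqF.
pose r := Num.sqrt q; have rr : r ^+ 2 = q by rewrite sqr_sqrtr.
pose a j := 2 * deviation w j / (p j) * h.
pose b j := (p j)^-1 - 1.
have step j : pearson_word n (rcons w j) = r ^+ 2 + (a j * h + b j * h ^+ 2).
  rewrite pearson_word_rcons -/q rr; congr (_ + _).
  by rewrite [LHS]mulrDl -hh /a /b; ring.
pose M : R := expR (- (c * q)) * (1 - c * m * n%:R^-1 + 2 * c ^+ 2 * q * n%:R^-1).
have pU j : p j != 0 by rewrite gt_eqF.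
(* sum p_j a_j = 0, sum p_j b_j = m and sum p_j a_j^2 = 4 q *)
have mid : M = \sum_j p j * (expR (- (c * r ^+ 2)) *
     (1 - c * (a j * h + b j * h ^+ 2) + (c * a j * h) ^+ 2 / 2)).
  under eq_bigr => j _.
    rewrite mulrCA (_ : p j * _ = p j - c * h ^+ 2 * (2 * deviation w j)
       - c * h ^+ 2 * (1 - p j) +
       2 * c ^+ 2 * h ^+ 2 * (deviation w j ^+ 2 / (n%:R * p j))); last first.
      rewrite [n%:R](_ : _ = (h ^+ 2)^-1); last by rewrite hh invrK.
      by rewrite /a /b; field; rewrite pU hU.
    over.
  rewrite -mulr_sumr /M rr; congr (_ * _).
  rewrite !big_split /= !sumrN -!mulr_sumr sum_deviation big_split /= sumrN p_sum1.
  rewrite sumr_const card_ord -/(pearson_word n w) -/q hh /m.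
  by ring.
have left :
    `|\sum_j p j * expR (- (c * pearson_word n (rcons w j))) - M| <= K1 * h ^+ 3.
  rewrite mid -sumrB; apply: (le_trans (ler_norm_sum _ _ _)).
  rewrite -[leRHS]mul1r -[X in X * (K1 * _)]p_sum1 mulr_suml; apply: ler_sum => j _.
  rewrite -mulrBr normrM (gtr0_norm (p_gt0 j)) ler_wpM2l ?(ltW (p_gt0 j)) //.
  rewrite step; apply: H1 => //.
  - exact: sqrtr_ge0.
  - rewrite -(@ler_pXn2r _ 2) ?nnegrE ?mulr_ge0 ?sqrtr_ge0 //.
    rewrite real_normK ?num_real // (exprMn _ D) rr.
    apply: (@le_trans _ _ (4 / p j * (deviation w j ^+ 2 / (n%:R * p j)))).
      rewrite /a [leLHS](_ : _ = 4 * deviation w j ^+ 2 / p j ^+ 2 * h ^+ 2); last first.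
        by field; rewrite pU.
      by rewrite hh le_eqVlt; apply/orP; left; apply/eqP; field; rewrite pU.
    apply: ler_pM; rewrite ?divr_ge0 ?(ltW (p_gt0 j)) ?sqr_ge0 //.
    + by rewrite mulr_ge0 // ltW.
    + apply: (@le_trans _ _ D) => //; rewrite expr2 ler_peMr //.
      apply: (le_trans _ (D4 j)); rewrite ler_pdivlMr //.
      by have := p_le1 j; lra.
    + exact: sqr_deviation_le.
  - rewrite /b; apply/andP; split.
      by rewrite subr_ge0 -[leLHS]invr1 lef_pV2 ?posrE // p_le1.
    apply: (le_trans _ (D4 j)).
    have : 0 < (p j)^-1 by rewrite invr_gt0.
    by lra.
  - by rewrite (ltW h0).
have n1 : 0 <= (n%:R^-1 : R) <= 1 by rewrite -hh sqr_ge0 exprn_ile1 // ltW.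
have right := H2 _ _ _ cI q0 n1.
have hhh : n%:R^-1 ^+ 2 <= h ^+ 3.
  by rewrite -hh -exprM (exprS _ 3) ler_piMl // exprn_ge0 // ltW.
rewrite -(subrKA M); apply: (le_trans (ler_normD _ _)); rewrite [leRHS]mulrDl lerD //.
rewrite distrC; apply: (le_trans right); exact: ler_wpM2l.
Qed.

Lemma pearson_word_laplace_bound l : 0 < l ->
  exists2 K, 0 <= K & forall n, (0 < n)%N ->
  `|word_mean n (fun w => expR (- (l * pearson_word n w))) -
    expR (- (m / 2 * ln (1 + 2 * l)))| <= K * (Num.sqrt n%:R)^-1.
Proof.
move=> l0; have l1 : 0 < 1 + 2 * l by lra.
(* The parameters [c i] increase from l / (1 + 2 l) at i = 0 to l at i = n. *)
have c0gt0 : 0 < l / (1 + 2 * l) by rewrite divr_gt0.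
have [K K0 H] := @pearson_word_step _ l c0gt0 (ltW l0).
exists K => // n n0; set h := (Num.sqrt n%:R)^-1.
have nR : 0 < n%:R :> R by rewrite ltr0n.
(* [x i] is the denominator 1 + 2 l s of u at remaining time s = 1 - i / n, and [Phi i] is E u(1 - i
   / n, Q_i). [Phi n] is the Laplace transform and [Phi 0] the claimed limit; n steps of size K
   n^(-3/2) give K n^(-1/2). *)
pose x i : R := 1 + 2 * l * ((n%:R - i%:R) / n%:R).
pose c i : R := l / x i.
pose G i : R := expR (- (m / 2 * ln (x i))).
pose Phi i : R := G i * word_mean i (fun w => expR (- (c i * pearson_word n w))).
have x1 i : (i <= n)%N -> 1 <= x i.
  move=> ni; rewrite lerDl; apply: mulr_ge0; first by lra.
  by rewrite divr_ge0 ?(ltW nR) // subr_ge0 ler_nat.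
have x2 i : x i <= 1 + 2 * l.
  rewrite lerD2l ler_piMr //; first by lra.
  by rewrite ler_pdivrMr // mul1r gerBl.
suff bnd i : (i <= n)%N -> `|Phi i - Phi 0%N| <= i%:R * (K * h ^+ 3).
  have := bnd n (leqnn n).
  have xn : x n = 1 by rewrite /x subrr mul0r mulr0 addr0.
  have x0 : x 0%N = 1 + 2 * l by rewrite /x subr0 divff ?mulr1 // gt_eqF.
  have S0 : pearson_word n [::] = 0.
    by apply: big1 => j _; rewrite /deviation /= mul0r subrr expr0n mul0r.
  rewrite /Phi /= /G /c xn x0 S0 ln1 mulr0 oppr0 expR0 mul1r.
  rewrite mulr0 oppr0 expR0 mulr1 divr1 => /le_trans; apply.
  have hh : h ^+ 2 = n%:R^-1 by rewrite exprVn sqr_sqrtr // ltW.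
  rewrite (exprS _ 2) hh le_eqVlt; apply/orP; left; apply/eqP.
  by field; rewrite gt_eqF.
elim: i => [|i IH] ni; first by rewrite subrr normr0 mul0r.
rewrite -(subrKA (Phi i)); apply: (le_trans (ler_normD _ _)).
rewrite -[X in _ <= X * _]natr1 [leRHS]mulrDl mul1r [leRHS]addrC lerD //;
  last exact: IH (ltnW ni).
have xp : 0 < x i.+1 by rewrite (lt_le_trans _ (x1 _ ni)).
(* Semigroup property: flowing for a further time 1 / n turns the parameters of index i + 1 into
   those of index i, in the prefactor ([GS]) and in the exponent ([cS]). *)
have xS : x i = x i.+1 * (1 + 2 * c i.+1 / n%:R).
  transitivity (x i.+1 + 2 * l / n%:R).
    by rewrite /x -natr1; field; rewrite gt_eqF.
  by rewrite /c; field; rewrite !gt_eqF.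
have cp : 0 < c i.+1 by rewrite divr_gt0.
have dp : 0 < 1 + 2 * c i.+1 / n%:R.
  by rewrite ltr_wpDr // divr_ge0 ?(ltW nR) // mulr_ge0 // ltW.
have GS : G i = G i.+1 * expR (- (m / 2 * ln (1 + 2 * c i.+1 / n%:R))).
  rewrite /G xS lnM ?posrE // -expRD; congr expR; ring.
have cS : c i = c i.+1 / (1 + 2 * c i.+1 / n%:R).
  by rewrite {1}/c xS invfM mulrA.
have G1 : G i.+1 <= 1.
  rewrite /G -expR0 ler_expR oppr_le0 mulr_ge0 ?divr_ge0 //.
  by rewrite ln_ge0 // x1.
rewrite /Phi GS cS -mulrA -mulrBr normrM ger0_norm ?expR_ge0 //.
rewrite -[leRHS]mul1r; apply: ler_pM; rewrite ?expR_ge0 //.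
rewrite -word_meanZ /=; apply: word_mean_dist => w wi.
apply: H => //; apply/andP; split.
  by rewrite /c ler_wpM2l ?(ltW l0) // lef_pV2 ?posrE.
by rewrite /c ler_pdivrMr // ler_peMr ?x1 // ltW.
Qed.

End word_mean.

(** * Convergence of Laplace transforms implies convergence in distribution *)

Section bernstein.
Context {R : realType}.
Implicit Types (f g : nat -> R) (u : R).

(* The polynomial u |-> E f(B) for B binomial (n, u). *)
Fixpoint bernstein n f : {poly R} :=
  if n is m.+1 then 'X * bernstein m (f \o S) + (1 - 'X) * bernstein m f
  else (f 0)%:P.

Lemma horner_bernsteinS n f u : (bernstein n.+1 f).[u] =
  u * (bernstein n (f \o S)).[u] + (1 - u) * (bernstein n f).[u].
Proof. by rewrite /= !hornerE. Qed.

Lemma bernstein_cst n a u : (bernstein n (fun=> a)).[u] = a.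
Proof.
elim: n => [|n IH]; first by rewrite hornerC.
by rewrite horner_bernsteinS [_ \o _](_ : _ = fun=> a) // IH; ring.
Qed.

Lemma bernstein_linear n a f g u :
  (bernstein n (fun i => a * f i + g i)).[u] =
  a * (bernstein n f).[u] + (bernstein n g).[u].
Proof.
elim: n f g => [|n IH] f g; first by rewrite !hornerC.
rewrite !horner_bernsteinS.
rewrite [(fun i => a * f i + g i) \o S](_ : _ =
  fun i => a * (f \o S) i + (g \o S) i) //.
by rewrite !IH; ring.
Qed.

Lemma le_bernstein n f g u : 0 <= u <= 1 -> (forall i, f i <= g i) ->
  (bernstein n f).[u] <= (bernstein n g).[u].
Proof.
move=> /andP[u0 u1]; elim: n f g => [|n IH] f g fg; first by rewrite !hornerC.
rewrite !horner_bernsteinS lerD // ler_wpM2l ?subr_ge0 //; apply: IH => i //.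
exact: fg.
Qed.

Lemma bernstein_dist n c f g u : 0 <= u <= 1 -> (forall i, `|f i - c| <= g i) ->
  `|(bernstein n f).[u] - c| <= (bernstein n g).[u].
Proof.
move=> u01 fg; rewrite ler_norml lerBrDr lerBlDr addrC lerBlDr.
have {fg}fg i : c <= 1 * f i + g i /\ f i <= 1 * g i + c.
  by have := fg i; rewrite ler_norml => /andP[? ?]; split; lra.
apply/andP; split.
  rewrite -[leLHS](bernstein_cst n c u) -[X in _ <= X + _]mul1r -bernstein_linear.
  by apply: le_bernstein => // i; have [] := fg i.
rewrite -[X in _ <= _ + X](bernstein_cst n c u) -[X in _ <= X + _]mul1r.
by rewrite -bernstein_linear; apply: le_bernstein => // i; have [] := fg i.
Qed.

(** A binomial variance plus a squared bias. The shift a carries the induction: conditioning on one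
    trial moves it by 1 - u or by - u. *)
Lemma bernstein_sqr n a u :
  (bernstein n (fun i => (i%:R - n%:R * u + a) ^+ 2)).[u] =
  a ^+ 2 + n%:R * (u * (1 - u)).
Proof.
elim: n a => [|n IH] a; first by rewrite hornerC; ring.
rewrite horner_bernsteinS.
rewrite [_ \o _](_ : _ = fun i => (i%:R - n%:R * u + (a + 1 - u)) ^+ 2); last first.
  by apply/funext => i /=; rewrite -!natr1; ring.
rewrite [X in _ + (1 - u) * (bernstein n X).[u]](_ : _ =
    fun i => (i%:R - n%:R * u + (a - u)) ^+ 2); last first.
  by apply/funext => i /=; rewrite -!natr1; ring.
by rewrite !IH -natr1; ring.
Qed.

(** The inequality |t| <= t ^ 2 / dl + dl takes the place of Chebyshev truncation, so the binomial
    variance controls the error directly. *)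
Lemma bernstein_approx (g : R -> R) (L e : R) : 0 < L -> 0 < e ->
  (forall u v, `|g u - g v| <= L * `|u - v|) ->
  exists B : {poly R}, forall u, 0 <= u <= 1 -> `|B.[u] - g u| <= e.
Proof.
(* With this [dl] the constant part L dl equals e / 2; [n] is chosen to make the variance part, at
   most L / (n dl), no larger than e / 2. *)
move=> L0 e0 gL; pose dl := e / (2 * L).
have dl0 : 0 < dl by rewrite divr_gt0 // mulr_gt0.
pose n := (Num.bound (L / (dl * (e / 2)))).+1.
have n0 : 0 < n%:R :> R by rewrite ltr0n.
have nL : L / (n%:R * dl) <= e / 2.
  have h : L / (dl * (e / 2)) <= n%:R.
    apply: (@le_trans _ _ (Num.bound (L / (dl * (e / 2))))%:R).
      apply/ltW/archi_boundP; apply/ltW/divr_gt0 => //.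
      by apply: mulr_gt0 => //; exact: divr_gt0.
    by rewrite ler_nat.
  rewrite ler_pdivrMr; last exact: mulr_gt0.
  have e20 : 0 < dl * (e / 2) by apply: mulr_gt0 => //; exact: divr_gt0.
  rewrite ler_pdivrMr // in h.
  by rewrite (le_trans h) // le_eqVlt; apply/orP; left; apply/eqP; ring.
exists (bernstein n (fun i => g (i%:R / n%:R))); move=> u u01.
pose s i : R := (i%:R - n%:R * u + 0) ^+ 2.
pose A : R := L / (n%:R ^+ 2 * dl).
have A0 : 0 < A by apply: divr_gt0 => //; apply: mulr_gt0 => //; exact: exprn_gt0.
have gi i : `|g (i%:R / n%:R) - g u| <= A * s i + L * dl.
  apply: (le_trans (gL _ _)).
  set t := i%:R / n%:R - u.
  rewrite (_ : A * s i + L * dl = L * (t ^+ 2 / dl + dl)); last first.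
    by rewrite /A /s /t; field; rewrite !gt_eqF.
  rewrite ler_wpM2l ?(ltW L0) //.
  rewrite -(@ler_pM2r _ dl) // mulrDl divfK ?gt_eqF //.
  rewrite -[t ^+ 2]real_normK ?num_real //.
  have := normr_ge0 t; move: `|t| => v v0.
  have : 0 <= (v - dl / 2) ^+ 2 by rewrite sqr_ge0.
  have : 0 <= dl ^+ 2 by rewrite sqr_ge0.
  by nra.
have bs : (bernstein n (fun i => A * s i + L * dl)).[u] <= e.
  rewrite (bernstein_linear _ _ s (fun=> L * dl)) bernstein_cst bernstein_sqr.
  rewrite (_ : L * dl = e / 2); last by rewrite /dl; field; rewrite gt_eqF.
  have uu : u * (1 - u) <= 1 by case/andP: u01 => *; nra.
  have : A * (0 ^+ 2 + n%:R * (u * (1 - u))) <= e / 2; last by lra.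
  apply: le_trans nL; rewrite expr0n add0r.
  rewrite (_ : A * _ = L / (n%:R * dl) * (u * (1 - u))); last first.
    by rewrite /A; field; rewrite !gt_eqF.
  by rewrite ler_piMr // divr_ge0 ?(ltW L0) // mulr_ge0 // ltW.
exact: le_trans (bernstein_dist n u01 gi) bs.
Qed.

End bernstein.

Section ramp.
Context {R : realType}.
Implicit Types a b u v x y : R.

Definition ramp a b u : R := Num.max 0 (Num.min 1 ((u - a) / (b - a))).

Lemma ramp_ge0 a b u : 0 <= ramp a b u.
Proof. by rewrite /ramp le_max lexx. Qed.

Lemma ramp_le1 a b u : ramp a b u <= 1.
Proof. by rewrite /ramp ge_max ler01 /= ge_min lexx. Qed.

Lemma ramp_lipschitz a b u v : a < b ->
  `|ramp a b u - ramp a b v| <= (b - a)^-1 * `|u - v|.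
Proof.
move=> ab; have i0 : 0 < (b - a)^-1 by rewrite invr_gt0 subr_gt0.
rewrite -[X in _ <= X * _](gtr0_norm i0) -normrM.
rewrite (_ : _^-1 * _ = (u - a) / (b - a) - (v - a) / (b - a)); last by ring.
rewrite /ramp; move: (_ / _) (_ / _) => t s.
have clampP (r : R) : [\/ Num.max 0 (Num.min 1 r) = 0 /\ r <= 0,
    Num.max 0 (Num.min 1 r) = r /\ 0 <= r <= 1 |
    Num.max 0 (Num.min 1 r) = 1 /\ 1 <= r].
  have [r1|r1] := leP 1 r; first by constructor 3; rewrite max_r.
  have [r0|r0] := leP r 0; first by constructor 1.
  by constructor 2; rewrite ?(ltW r0) ?(ltW r1).
have h : forall r : R, - `|r| <= r <= `|r| by move=> r; rewrite -ler_norml.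
have /andP[h1 h2] := h (s - t).
by case: (clampP s) (clampP t) => -[-> hs] [] [-> ht];
  try case/andP: hs => ? ?; try case/andP: ht => ? ?;
  rewrite ler_norml; apply/andP; split; lra.
Qed.

Lemma measurable_ramp a b : measurable_fun setT (ramp a b).
Proof.
apply: measurable_maxr => //; apply: measurable_minr => //.
apply: measurable_funM => //; exact: measurable_funB.
Qed.

(** The half-line q <= x becomes exp (- q) >= exp (- x), whose indicator is discontinuous; the ramp
    supplies a Lipschitz function of exp (- q) between two such indicators. *)
Lemma le_ramp_expR x y q : x < y ->
  (q <= x)%R%:R <= ramp (expR (- y)) (expR (- x)) (expR (- q)) <= (q <= y)%R%:R.
Proof.
move=> xy; have exy : expR (- y) < expR (- x) by rewrite ltr_expR ltrN2.
have d0 : 0 < expR (- x) - expR (- y) by rewrite subr_gt0.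
apply/andP; split.
  case: (leP q x) => qx; last exact: ramp_ge0.
  rewrite /ramp le_max le_min lexx /=; apply/orP; right.
  by rewrite ler_pdivlMr // mul1r lerB // ler_expR lerN2.
case: (leP q y) => qy; first exact: ramp_le1.
rewrite /ramp ge_max lexx ge_min /=; apply/orP; right.
by rewrite pmulr_lle0 ?invr_gt0 // subr_le0 ler_expR lerN2 ltW.
Qed.

End ramp.

Lemma bounded_integrable d (Z : measurableType d) (R : realType)
    (nu : probability Z R) (f : Z -> R) (M : R) :
  measurable_fun setT f -> (forall z, `|f z| <= M) ->
  nu.-integrable setT (EFin \o f).
Proof.
move=> mf fM; apply: measurable_bounded_integrable => //.
  by rewrite -ge0_fin_numE ?fin_num_measure.
exists M; split; first exact: num_real.
by move=> N MN z _; exact: le_trans (fM z) (ltW MN).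
Qed.

(* A continuity theorem for Laplace transforms at the integers. The approximating
   laws enter only through their expectations, as functionals on functions of
   y >= 0, so that finite sums and integrals are covered alike. *)
Section laplace_continuity.
Context d (Z : measurableType d) (R : realType) (nu : probability Z R).
Variables (S : {RV nu >-> R}) (E : nat -> (R -> R) -> R).
Hypothesis S_ge0 : forall z, 0 <= S z.
Hypothesis E_cst : forall n a, E n (fun=> a) = a.
Hypothesis E_linear : forall n a f g,
  E n (fun y => a * f y + g y) = a * E n f + E n g.
Hypothesis le_E : forall n f g, (forall y : R, 0 <= y -> f y <= g y) -> E n f <= E n g.
Hypothesis E_laplace : forall l : nat,
  E n (fun y => expR (- (l%:R * y))) @[n --> \oo] -->
  \int[nu]_z expR (- (l%:R * S z)).

Let expRS_itv z : 0 <= expR (- S z) <= 1.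
Proof. by rewrite expR_ge0 -expR0 ler_expR oppr_le0 S_ge0. Qed.

Let measurable_expRS : measurable_fun setT (fun z => expR (- S z)).
Proof. by apply: measurableT_comp => //; exact: measurableT_comp. Qed.

Let eq_E n f g : (forall y : R, 0 <= y -> f y = g y) -> E n f = E n g.
Proof.
by move=> fg; apply/eqP; rewrite eq_le !le_E // => y y0; rewrite fg.
Qed.

(** The power exp (- y) ^ i is the Laplace kernel at the integer i, so [E_laplace] handles each term
    and linearity the sum. *)
Let power_sum_cvg m (c : nat -> R) :
  E n (fun y => \sum_(i < m) c i * expR (- y) ^+ i) @[n --> \oo] -->
  \int[nu]_z (\sum_(i < m) c i * expR (- S z) ^+ i).
Proof.
have expX (y : R) i : expR (- y) ^+ i = expR (- (i%:R * y)).
  by rewrite -expRM_natl mulrN.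
have intX i : nu.-integrable setT (EFin \o (fun z => expR (- S z) ^+ i)).
  apply: (@bounded_integrable _ _ _ _ _ 1); first exact: measurable_funX.
  move=> z; have /andP[u0 u1] := expRS_itv z.
  by rewrite ger0_norm ?exprn_ge0 // exprn_ile1.
have intZ i : nu.-integrable setT (EFin \o (fun z => c i * expR (- S z) ^+ i)).
  have -> : EFin \o (fun z => c i * expR (- S z) ^+ i) =
      (fun z => (c i)%:E * (expR (- S z) ^+ i)%R%:E)%E.
    by apply/funext => z /=; rewrite EFinM.
  by apply: integrableZl => //; exact: intX.
have intS k : nu.-integrable setT
    (EFin \o (fun z => \sum_(i < k) c i * expR (- S z) ^+ i)).
  rewrite [EFin \o _](_ : _ = fun z =>
      (\sum_(i < k) (c i * expR (- S z) ^+ i)%R%:E)%E); last first.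
    by apply/funext => z /=; rewrite sumEFin.
  by apply: integrable_sum => // i _; exact: intZ.
elim: m => [|m IH].
  have E0 n : E n (fun y => \sum_(i < 0) c i * expR (- y) ^+ i) = 0.
    by rewrite -[RHS](E_cst n); apply: eq_E => y _; rewrite big_ord0.
  under eq_cvg do rewrite E0.
  under eq_Rintegral do rewrite big_ord0.
  by rewrite Rintegral_cst // mul0r; exact: cvg_cst.
have -> : (\int[nu]_z (\sum_(i < m.+1) c i * expR (- S z) ^+ i)) =
    c m * (\int[nu]_z expR (- (m%:R * S z))) +
    \int[nu]_z (\sum_(i < m) c i * expR (- S z) ^+ i).
  under eq_Rintegral do rewrite big_ord_recr /= addrC.
  rewrite (RintegralD _ (intZ m) (intS m)) //.
  rewrite (RintegralZl _ _ (intX m)) //.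
  by congr (_ * _ + _); apply: eq_Rintegral => z _; rewrite expX.
have EE n : E n (fun y => \sum_(i < m.+1) c i * expR (- y) ^+ i) =
    c m * E n (fun y => expR (- (m%:R * y))) +
    E n (fun y => \sum_(i < m) c i * expR (- y) ^+ i).
  rewrite -E_linear; apply: eq_E => y _.
  by rewrite big_ord_recr /= addrC expX.
under eq_cvg do rewrite EE.
by apply: cvgD => //; apply: cvgM; [exact: cvg_cst|exact: E_laplace].
Qed.

Lemma poly_laplace_cvg (B : {poly R}) :
  E n (fun y => B.[expR (- y)]) @[n --> \oo] --> \int[nu]_z B.[expR (- S z)].
Proof.
under eq_cvg do under [X in E _ X]funext => y do rewrite horner_coef.
under eq_Rintegral do rewrite horner_coef.
exact: power_sum_cvg.
Qed.

(** For y >= 0 the point exp (- y) lies in [0, 1], where some polynomial is within e / 3 of g.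
    Monotonicity carries this to [E n] and to the integral; convergence for the polynomial supplies
    the last third. *)
Lemma lipschitz_laplace_cvg (g : R -> R) (L : R) : 0 < L ->
  (forall u v, `|g u - g v| <= L * `|u - v|) ->
  (forall u, 0 <= g u <= 1) -> measurable_fun setT g ->
  E n (fun y => g (expR (- y))) @[n --> \oo] --> \int[nu]_z g (expR (- S z)).
Proof.
move=> L0 gL g01 mg; apply/cvgrPdist_le => e e0.
have e3 : 0 < e / 3 by rewrite divr_gt0.
have [B HB] := bernstein_approx L0 e3 gL.
have /cvgrPdist_le/(_ _ e3) := @poly_laplace_cvg B.
apply: filterS => n BE.
have intg : nu.-integrable setT (EFin \o (fun z => g (expR (- S z)))).
  apply: (@bounded_integrable _ _ _ _ _ 1); first exact: measurableT_comp.
  by move=> z; have /andP[? ?] := g01 (expR (- S z)); rewrite ger0_norm.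
have mB : measurable_fun setT (fun z => B.[expR (- S z)]).
  under eq_fun do rewrite horner_coef.
  apply: measurable_sum => i; apply: measurable_funM => //.
  exact: measurable_funX.
have intB : nu.-integrable setT (EFin \o (fun z => B.[expR (- S z)])).
  apply: (@bounded_integrable _ _ _ _ _ (1 + e / 3)) => // z.
  have := HB _ (expRS_itv z); have := g01 (expR (- S z)).
  by rewrite !ler_norml => /andP[? ?] /andP[? ?]; apply/andP; split; lra.
have inte a : nu.-integrable setT (EFin \o (fun=> a)).
  by apply: (@bounded_integrable _ _ _ _ _ `|a|).
have J a f : nu.-integrable setT (EFin \o f) ->
    \int[nu]_z (f z + a) = \int[nu]_z f z + a.
  move=> intf; rewrite RintegralD // Rintegral_cst //.
  by have := @probability_setT _ _ _ nu => /= ->; rewrite mulr1.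
have /= J1 : \int[nu]_z g (expR (- S z)) <= \int[nu]_z (B.[expR (- S z)] + e / 3).
  apply: le_Rintegral => //; first by apply: integrableD (intB) (inte _).
  by move=> z _; have := HB _ (expRS_itv z); rewrite ler_norml => /andP[? ?]; lra.
have J2 : \int[nu]_z B.[expR (- S z)] <= \int[nu]_z (g (expR (- S z)) + e / 3).
  apply: le_Rintegral => //; first by apply: integrableD (intg) (inte _).
  by move=> z _; have := HB _ (expRS_itv z); rewrite ler_norml => /andP[? ?]; lra.
rewrite !J // in J1 J2.
have HBy y : 0 <= y -> `|B.[expR (- y)] - g (expR (- y))| <= e / 3.
  by move=> y0; apply: HB; rewrite expR_ge0 -expR0 ler_expR oppr_le0.
have EJ f : E n (fun y => f y + e / 3) = E n f + e / 3.
  rewrite -[X in _ = _ + X](E_cst n) -[X in _ = X + _]mul1r -E_linear.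
  by apply: eq_E => y _; rewrite mul1r.
have E1 : E n (fun y => g (expR (- y))) <= E n (fun y => B.[expR (- y)] + e / 3).
  by apply: le_E => y /HBy; rewrite ler_norml => /andP[? ?]; lra.
have E2 : E n (fun y => B.[expR (- y)]) <= E n (fun y => g (expR (- y)) + e / 3).
  by apply: le_E => y /HBy; rewrite ler_norml => /andP[? ?]; lra.
rewrite !EJ in E1 E2.
by move: BE; rewrite !ler_norml => /andP[? ?]; apply/andP; split; lra.
Qed.

(** One ramp descends in q between x - dl / 2 and x, another between x and x + dl / 2. They enclose
    the indicator of q <= x, and their integrals are controlled by the distribution function at the
    outer points, so continuity at x closes the gap. *)
Lemma cdf_laplace_cvg x : {for x, continuous (cdf S)} ->
  E n (fun y => (y <= x)%R%:R) @[n --> \oo] --> fine (cdf S x).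
Proof.
move=> cF; pose F y := fine (cdf S y).
have finF y : cdf S y \is a fin_num.
  by rewrite /cdf fin_num_measure.
have cF' : F y @[y --> x] --> F x.
  apply: fine_cvg; rewrite fineK //; exact: cF.
have indicE' y : (fun z => (S z <= y)%R%:R : R) = \1_(S @^-1` `]-oo, y]).
  apply/funext => z; rewrite indicE; congr (nat_of_bool _)%:R; apply/idP/idP.
    by move=> ?; rewrite inE /= in_itv.
  by rewrite inE /= in_itv.
have mS y : measurable (S @^-1` `]-oo, y]).
  by rewrite -[X in measurable X]setTI; exact: measurable_funPT.
have indicF y : \int[nu]_z (S z <= y)%R%:R = F y.
  rewrite indicE' /F /cdf /distribution /pushforward -[X in nu X]setIT.
  by rewrite -integral_indic.
have mI y : measurable_fun setT (fun z => (S z <= y)%R%:R : R).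
  by rewrite indicE'; exact: measurable_indic.
have intI y : nu.-integrable setT (EFin \o (fun z => (S z <= y)%R%:R : R)).
  apply: (@bounded_integrable _ _ _ _ _ 1) => // z.
  by rewrite normr_nat lern1 leq_b1.
have rampP y y' : y < y' ->
    E n (fun q => ramp (expR (- y')) (expR (- y)) (expR (- q))) @[n --> \oo] -->
      \int[nu]_z ramp (expR (- y')) (expR (- y)) (expR (- S z)) /\
    F y <= \int[nu]_z ramp (expR (- y')) (expR (- y)) (expR (- S z)) <= F y'.
  move=> yy'; have ey : expR (- y') < expR (- y) by rewrite ltr_expR ltrN2.
  have intr : nu.-integrable setT
      (EFin \o (fun z => ramp (expR (- y')) (expR (- y)) (expR (- S z)))).
    apply: (@bounded_integrable _ _ _ _ _ 1).
      by apply: measurableT_comp => //; exact: measurable_ramp.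
    by move=> z; rewrite ger0_norm ?ramp_ge0 // ramp_le1.
  split.
    apply: (@lipschitz_laplace_cvg _ (expR (- y) - expR (- y'))^-1).
    - by rewrite invr_gt0 subr_gt0.
    - by move=> u v; exact: ramp_lipschitz.
    - by move=> u; rewrite ramp_ge0 ramp_le1.
    - exact: measurable_ramp.
  rewrite -!indicF; apply/andP; split; apply: le_Rintegral => // z _.
    by have /andP[] := le_ramp_expR (S z) yy'.
  by have /andP[] := le_ramp_expR (S z) yy'.
apply/cvgrPdist_le => e e0; rewrite -/(F x).
have squeeze (F0 Fl Fr Il Ir El Er Em : R) : Fl <= Il -> Ir <= Fr ->
    `|F0 - Fl| <= e / 2 -> `|F0 - Fr| <= e / 2 -> `|Il - El| <= e / 2 ->
    `|Ir - Er| <= e / 2 -> El <= Em -> Em <= Er -> `|F0 - Em| <= e.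
  clear; move=> ? ?; rewrite !ler_norml.
  move=> /andP[? ?] /andP[? ?] /andP[? ?] /andP[? ?] ? ?.
  by apply/andP; split; lra.
have e2 : 0 < e / 2 by rewrite divr_gt0.
have /cvgrPdist_le/(_ _ e2) /nbhs_ballP[dl /= dl0 Hdl] := cF'.
have near y : `|x - y| < dl -> `|F x - F y| <= e / 2 by exact: Hdl.
have dl2 : 0 < dl / 2 by rewrite divr_gt0.
have dl2dl : dl / 2 < dl by rewrite gtr_pMr // invf_lt1 // ltr1n.
have xl : x - dl / 2 < x by rewrite gtrBl.
have xr : x < x + dl / 2 by rewrite ltrDl.
have [/cvgrPdist_le/(_ _ e2) cl /andP[Fl _]] := rampP _ _ xl.
have [/cvgrPdist_le/(_ _ e2) cr /andP[_ Fr]] := rampP _ _ xr.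
have nl : `|F x - F (x - dl / 2)| <= e / 2.
  by apply: near; rewrite subKr gtr0_norm.
have nr : `|F x - F (x + dl / 2)| <= e / 2.
  by apply: near; rewrite opprD addrA subrr add0r normrN gtr0_norm.
near=> n.
have hl : `|\int[nu]_z ramp (expR (- x)) (expR (- (x - dl / 2))) (expR (- S z)) -
   E n (fun q => ramp (expR (- x)) (expR (- (x - dl / 2))) (expR (- q)))| <= e / 2.
  by near: n.
have hr : `|\int[nu]_z ramp (expR (- (x + dl / 2))) (expR (- x)) (expR (- S z)) -
   E n (fun q => ramp (expR (- (x + dl / 2))) (expR (- x)) (expR (- q)))| <= e / 2.
  by near: n.
have el : E n (fun q => ramp (expR (- x)) (expR (- (x - dl / 2))) (expR (- q))) <=
    E n (fun y => (y <= x)%R%:R).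
  by apply: le_E => q _; have /andP[] := le_ramp_expR q xl.
have er : E n (fun y => (y <= x)%R%:R) <=
    E n (fun q => ramp (expR (- (x + dl / 2))) (expR (- x)) (expR (- q))).
  by apply: le_E => q _; have /andP[] := le_ramp_expR q xr.
exact: squeeze Fl Fr nl nr hl hr el er.
Unshelve. all: by end_near. Qed.

End laplace_continuity.

(** * Laplace transform of the chi-square distribution *)

Section chi_square_laplace.
Context {R : realType}.
Local Notation mu := (@lebesgue_measure R).

(** The Radon-Nikodym derivative of the normal law agrees almost everywhere with the density, since
    both have the same integral over every measurable set. *)
Lemma integral_normal_prob (m s : R) (f : R -> \bar R) :
  (normal_prob m s).-integrable setT f ->
  (\int[normal_prob m s]_x f x = \int[mu]_x (f x * (normal_pdf m s x)%:E))%E.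
Proof.
move=> intf; have mf := measurable_int _ intf.
have ndom := normal_prob_dominates m s.
rewrite -(Radon_Nikodym_change_of_variables ndom) //=.
apply: ae_eq_integral => //.
- apply: emeasurable_funM; first exact: mf.
  apply: (measurable_int mu); apply: Radon_Nikodym_integrable.
  exact: normal_prob_dominates.
- apply: emeasurable_funM; first exact: mf.
  by apply/measurable_EFinP; exact: measurable_normal_pdf.
- apply: ae_eqe_mul2l => /=.
  rewrite Radon_NikodymE//=.
  case: cid => /= h [h1 h2 h3].
  apply: integral_ae_eq => //=.
  + by apply/measurable_EFinP; exact: measurable_normal_pdf.
  + by move=> E _ mE; rewrite -h3.
Qed.

(** With s = (1 + 2 l)^(-1/2), the product of exp (- l x ^ 2) and the standard normal density is s
    times the centred normal density of standard deviation s. *)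
Lemma normal_laplace (l : R) : 0 <= l ->
  (\int[normal_prob (0:R) 1]_x (expR (- (l * x ^+ 2)))%:E =
   (expR (- (2^-1 * ln (1 + 2 * l))))%:E)%E.
Proof.
move=> l0; have l1 : 0 < 1 + 2 * l by lra.
have mf : measurable_fun setT (fun x : R => expR (- (l * x ^+ 2))).
  apply: measurableT_comp => //; apply: measurableT_comp => //.
  by apply: measurable_funM => //; exact: measurable_funX.
rewrite integral_normal_prob; last first.
  apply: measurable_bounded_integrable => //.
    by rewrite -ge0_fin_numE ?fin_num_measure.
  exists 1; split; first exact: num_real.
  move=> N N1 z _; apply: le_trans (ltW N1); rewrite ger0_norm ?expR_ge0 //.
  by rewrite -expR0 ler_expR oppr_le0 mulr_ge0 ?sqr_ge0.
set s := expR _; have s0 : 0 < s by exact: expR_gt0.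
have ss : s ^+ 2 = (1 + 2 * l)^-1.
  by rewrite /s -expRM_natl mulrN mulrA divff // mul1r expRN lnK.
under eq_integral => x _.
  rewrite -EFinM (_ : expR _ * normal_pdf _ _ _ = s * normal_pdf 0 s x); last first.
    rewrite !normal_pdfE ?gt_eqF // /normal_peak /normal_fun expr1n mul1r.
    rewrite -mulrnAr sqrtrM ?sqr_ge0 // sqrtr_sqr (gtr0_norm s0).
    rewrite (_ : - (x - 0) ^+ 2 / (s ^+ 2 *+ 2) =
      - (l * x ^+ 2) + - (x - 0) ^+ 2 / (1 *+ 2)); last first.
      by rewrite ss subr0; field; rewrite gt_eqF.
    rewrite expRD; field; rewrite (gt_eqF s0) andbT.
    by rewrite gt_eqF // sqrtr_gt0 mulrn_wgt0 // pi_gt0.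
  rewrite EFinM.
  over.
rewrite ge0_integralZl //=.
- by rewrite integral_normal_pdf mule1.
- by apply/measurable_EFinP; exact: measurable_normal_pdf.
- by move=> x _; rewrite lee_fin normal_pdf_ge0.
- by rewrite lee_fin ltW.
Qed.

(** Tonelli splits off one coordinate at a time, and each contributes the factor of
    [normal_laplace]. *)
Lemma chi_square_laplace m (l : R) : 0 <= l ->
  (\int[iid_prob (normal_prob (0:R) 1) m]_t (expR (- (l * sum_sqr t)))%:E =
   (expR (- (m%:R / 2 * ln (1 + 2 * l))))%:E)%E.
Proof.
move=> l0.
have mE n : measurable_fun setT
    (fun t : n.-tuple (measurableTypeR R) => (expR (- (l * sum_sqr t)))%:E).
  apply/measurable_EFinP; apply: measurableT_comp => //.
  apply: measurableT_comp => //; apply: measurable_funM => //.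
elim: m => [|m IH].
  under eq_integral do rewrite /sum_sqr big_ord0 mulr0 oppr0 expR0.
  rewrite integral_cst // mul1e.
  have /= -> := @probability_setT _ _ _ (iid_prob (normal_prob (0:R) 1) 0).
  by rewrite !mul0r oppr0 expR0.
rewrite [iid_prob _ _]/= ge0_integral_distribution //=; last exact: mE.
rewrite fubini_tonelli1 /=; last 2 first.
- by apply: (measurableT_comp (mE m.+1)); exact: measurable_tcons.
- by move=> y; rewrite lee_fin expR_ge0.
rewrite /fubini_F /=.
have E (x : R) : (\int[iid_prob (normal_prob (0:R) 1) m]_y
    (expR (- (l * sum_sqr (tcons (x, y)))))%:E =
    (expR (- (m%:R / 2 * ln (1 + 2 * l))))%:E * (expR (- (l * x ^+ 2)))%:E)%E.
  under eq_integral => y _.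
    rewrite (_ : expR _ = expR (- (l * x ^+ 2)) * expR (- (l * sum_sqr y))); last first.
      rewrite -expRD -opprD -mulrDr /sum_sqr big_ord_recl /=; congr expR.
      congr (- (l * (_ + _))); apply: eq_bigr => i _.
      by rewrite tnthS.
    rewrite EFinM.
    over.
  rewrite ge0_integralZl //=.
  - by rewrite IH muleC.
  - exact: mE.
under eq_integral do rewrite E.
rewrite ge0_integralZl //=.
- rewrite normal_laplace // -EFinM -expRD; congr (expR _)%:E.
  by rewrite -natr1; field.
- apply/measurable_EFinP; apply: measurableT_comp => //.
  by apply: measurableT_comp => //; apply: measurable_funM.
Qed.

End chi_square_laplace.

(** * Reduction to words of outcomes *)

Section multinomial_trials.
Context d (T : measurableType d) (R : realType) (P : probability T R) (k : nat).
Variables (p : 'I_k -> R) (X : nat -> {RV P >-> k.-tuple R}).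
Hypothesis p_gt0 : forall j, 0 < p j.
Hypothesis X_indep : independent_RVs P X.
Hypothesis X_multinomial : forall i, multinomial1 P p (X i).

Definition basis_vector (j : 'I_k) : set (k.-tuple R) :=
  [set t | tnth t j = 1 /\ forall l, l != j -> tnth t l = 0].

Let measurable_tnth_eq (l : 'I_k) (a : R) :
  measurable [set t : k.-tuple R | tnth t l = a].
Proof.
rewrite -[X in measurable X]setTI.
exact: (measurable_tnth l measurableT (measurable_set1 a)).
Qed.

Lemma measurable_basis_vector j : measurable (basis_vector j).
Proof.
rewrite (_ : basis_vector j = [set t | tnth t j = 1] `&`
  \bigcap_(l in [set l | l != j]) [set t | tnth t l = 0]) //.
apply: measurableI => //; apply: fin_bigcap_measurable => //.
exact: finite_finset.
Qed.

Let trial i j := X i @^-1` basis_vector j.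

Let measurable_trial i j : measurable (trial i j).
Proof.
rewrite -[X in measurable X]setTI; apply: measurable_funPT => //.
exact: measurable_basis_vector.
Qed.

Let trial_disjoint i j l z : trial i j z -> trial i l z -> j = l.
Proof.
move=> [j1 _] [_ l0]; apply/eqP/negPn/negP => jl.
by move: j1; rewrite l0 // => /eqP; rewrite eq_sym oner_eq0.
Qed.

(** Law of total probability over the outcomes of trial i. They cover the space only up to a null
    set, since the shape of the vector is known almost surely. *)
Let trial_cover i C : measurable C -> (P C = \sum_j P (C `&` trial i j))%E.
Proof.
move=> mC; pose J := [set` index_enum 'I_k].
have mU : measurable (\bigcup_(j in J) trial i j).
  by apply: fin_bigcup_measurable => [|j _]; [exact: finite_finset|].
have full : P (C `\` \bigcup_(j in J) trial i j) = 0%E.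
  apply: measure_negligible; first exact: measurableD.
  have [[N [mN N0 sN]] _] := X_multinomial i.
  exists N; split => // z [_ nz]; apply: sN => -[j [j1 j0]].
  by apply: nz; exists j; [rewrite /J /= mem_index_enum|split].
transitivity (P (C `\` \bigcup_(j in J) trial i j) +
              P (C `&` \bigcup_(j in J) trial i j))%E; first exact: measureDI.
rewrite full add0e setI_bigcupr measure_fin_bigcup //; last 2 first.
- move=> j l _ _ [z [[_ zj] [_ zl]]]; exact: trial_disjoint zj zl.
- by move=> j _; exact: measurableI.
- by rewrite [RHS]fsbig_seq // index_enum_uniq.
- exact: finite_finset.
Qed.

(** The hypothesis concerns component j alone, while [trial] also asks the other components to
    vanish; the two events differ within the null set [N]. *)
Let prob_trial i j : P (trial i j) = (p j)%:E.
Proof.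
have [[N [mN N0 sN]] h] := X_multinomial i; have [<- _] := h j.
have m1 : measurable [set z | tnth (X i z) j = 1].
  rewrite [X in measurable X](_ : _ = setT `&` X i @^-1` [set t | tnth t j = 1]).
    by apply: measurable_funPT => //; exact: measurable_tnth_eq.
  by rewrite setTI.
apply/eqP; rewrite eq_le; apply/andP; split.
  by apply: le_measure; rewrite ?inE // => z [].
rewrite -[leRHS]adde0 -N0; apply: le_trans (measureU2 P _ _) => //.
apply: le_measure; rewrite ?inE //; first exact: measurableU.
move=> z /= z1; have [Nz|Nz] := pselect (N z); [by right|left].
have [l [l1 l0]] : exists j : 'I_k, tnth (X i z) j = 1 /\
    (forall l, l != j -> tnth (X i z) l = 0).
  by apply: contrapT => nz; apply: Nz; exact: sN.
have [<-|jl] := eqVneq l j; first by split.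
by move: z1; rewrite l0 1?eq_sym // => /eqP; rewrite eq_sym oner_eq0.
Qed.

(** Default letter for [nth]; words are read at indices below their length. *)
Variable j0 : 'I_k.

Let outcome (w : seq 'I_k) :=
  \bigcap_(i in [set` iota 0 (size w)]) trial i (nth j0 w i).

Let measurable_outcome w : measurable (outcome w).
Proof. exact: fin_bigcap_measurable. Qed.

Let outcome_rcons w j : outcome (rcons w j) = outcome w `&` trial (size w) j.
Proof.
apply/seteqP; split => z.
  move=> h; split.
    move=> i /=; rewrite mem_iota add0n => /= iw.
  have := h i; rewrite /= mem_iota size_rcons add0n ltnS (ltnW iw).
    rewrite nth_rcons iw.
    exact.
  have := h (size w); rewrite /= mem_iota size_rcons add0n ltnS leqnn.
  by rewrite nth_rcons ltnn eqxx; exact.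
move=> [h hj] i /=; rewrite mem_iota size_rcons add0n ltnS /= leq_eqVlt.
move=> /orP[/eqP ->|iw]; first by rewrite nth_rcons ltnn eqxx.
by rewrite nth_rcons iw; apply: h; rewrite /= mem_iota.
Qed.

Let prob_outcome w : P (outcome w) = (\prod_(j <- w) p j)%:E.
Proof.
rewrite /outcome (X_indep (B := fun i => basis_vector (nth j0 w i))); last 2 first.
- exact: iota_uniq.
- by move=> i; exact: measurable_basis_vector.
rewrite [in RHS](big_nth j0) /index_iota subn0 -prodEFin.
by apply: eq_bigr => i _; exact: prob_trial.
Qed.

(** Conditional probabilities given the first outcomes form a martingale ([GS]), so their mean over
    words of any length is P A. At length n the event is decided by the word, and they are 0 or
    1. *)
Lemma prob_word_mean n (A : set T) (b : pred (seq 'I_k)) : measurable A ->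
  (forall w z, size w = n ->
    (forall i, (i < n)%N -> basis_vector (nth j0 w i) (X i z)) -> A z <-> b w) ->
  P A = (word_mean p n (fun w => (b w)%:R))%:E.
Proof.
move=> mA Ab.
pose weight (w : seq 'I_k) := \prod_(j <- w) p j.
have weight0 w : weight w != 0 by rewrite gt_eqF // prodr_gt0.
(* G w is the conditional probability of A given that the trials start with w *)
pose G w := fine (P (A `&` outcome w)) / weight w.
have GS w : G w = \sum_j p j * G (rcons w j).
  rewrite /G (trial_cover (size w)); last exact: measurableI.
  rewrite -sum_fine => [|j _]; last first.
    by rewrite fin_num_measure //; do 2![apply: measurableI => //].
  rewrite mulr_suml; apply: eq_bigr => j _.
  rewrite outcome_rcons (setIA A) /weight -cats1 big_cat big_seq1 /=.
  by field; rewrite weight0 gt_eqF.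
have GE : word_mean p n G = fine (P A).
  have -> : fine (P A) = G [::].
    rewrite /G /weight big_nil divr1 (_ : outcome [::] = setT) ?setIT //.
    by apply/seteqP; split => // z _ i.
  elim: n {Ab} => [//|n IH] /=; rewrite -IH; apply: eq_word_mean => w _.
  by rewrite -GS.
rewrite -[LHS]fineK ?fin_num_measure // -GE; congr EFin.
apply: eq_word_mean => w wn; rewrite /G.
have {}Ab z : outcome w z -> A z <-> b w.
  by move=> oz; apply: Ab => // i iw; apply: oz; rewrite /= mem_iota wn.
case: (boolP (b w)) => bw.
  have -> : A `&` outcome w = outcome w.
    by apply/seteqP; split => [z []//|z oz]; split => //; apply/(Ab z oz).
  by rewrite prob_outcome /= divff ?weight0.
have -> : A `&` outcome w = set0.
  by apply/seteqP; split => // z [Az oz]; move/negP: bw; apply; apply/(Ab z oz).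
by rewrite measure0 mul0r.
Qed.

Lemma pearson_chi2_word n w z : size w = n ->
  (forall i, (i < n)%N -> basis_vector (nth j0 w i) (X i z)) ->
  pearson_chi2 p X n z = pearson_word p n w.
Proof.
move=> wn h; rewrite /pearson_chi2 /pearson_word; apply: eq_bigr => j _.
congr (_ ^+ 2 / _); rewrite /deviation wn; congr (_ - _).
rewrite /successes -sum1_count (big_nth j0) wn big_mkord natr_sum [RHS]big_mkcond /=.
apply: eq_bigr => i _; have [h1 h0] := h i (ltn_ord i).
by case: eqVneq => [<-|jn]; rewrite ?h1 // h0 // eq_sym.
Qed.

End multinomial_trials.

(** * Limit of the Laplace transforms and conclusion *)

Lemma pearson_word_laplace_cvg (R : realType) (k : nat) (p : 'I_k -> R) (l : R) :
  \sum_j p j = 1 -> (forall j, 0 < p j) -> 0 <= l ->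
  word_mean p n (fun w => expR (- (l * pearson_word p n w))) @[n --> \oo] -->
  expR (- ((k%:R - 1) / 2 * ln (1 + 2 * l))).
Proof.
(* At l = 0 both sides are 1; the quantitative bound is stated for l > 0. *)
move=> p1 p0; rewrite le_eqVlt => /predU1P[<-|l0].
  rewrite mulr0 addr0 ln1 mulr0 oppr0 expR0.
  under eq_cvg => n.
    under eq_word_mean do rewrite mul0r oppr0 expR0.
    rewrite word_mean_cst //.
    over.
  exact: cvg_cst.
have [K K0 HK] := pearson_word_laplace_bound p1 p0 l0.
apply/cvgrPdist_le => e e0; near=> n.
have n0 : (0 < n)%N by near: n; exact: nbhs_infty_gt.
have sn0 : 0 < Num.sqrt n%:R :> R by rewrite sqrtr_gt0 ltr0n.
rewrite distrC (le_trans (HK n n0)) // ler_pdivrMr // -ler_pdivrMl //.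
(* Writing K / e as the square root of its square reduces the claim to n >= (K / e) ^ 2. *)
rewrite -[leLHS]ger0_norm -?sqrtr_sqr; last by rewrite mulr_ge0 // invr_ge0 ltW.
rewrite ler_wsqrtr //.
near: n; exact: nbhs_infty_ger.
Unshelve. all: by end_near. Qed.

Theorem mainTheorem1 (R : realType) (d : measure_display) (T : measurableType d)
    (P : probability T R) (k : nat) (p : 'I_k -> R)
    (p_ge0 : forall j, 0 <= p j) (p_sum1 : \sum_(j < k) p j = 1)
    (* well-definedness of the quotients in the Pearson statistic *)
    (p_neq0 : forall j, p j != 0)
    (X : nat -> {RV P >-> k.-tuple R})
    (X_indep : independent_RVs P X)
    (X_multinomial : forall i, multinomial1 P p (X i)) :
  cvg_in_distribution P (fun n => pearson_chi2 p X n) (chi_square R k.-1).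
Proof.
have p_gt0 j : 0 < p j by rewrite lt0r p_neq0 p_ge0.
(* An empty sum is not 1. Positivity of k provides the default letter and makes [k.-1] the true
   difference k - 1. *)
have k0 : (0 < k)%N.
  rewrite lt0n; apply/negP => /eqP k0.
  have : \sum_j p j = 0 by apply: big1 => -[i ik]; exfalso; rewrite k0 in ik.
  by rewrite p_sum1 => /eqP; rewrite oner_eq0.
move=> x cF.
pose nu : probability (k.-1.-tuple (measurableTypeR R)) R :=
  iid_prob (normal_prob (0 : R) 1) k.-1.
pose S : {RV nu >-> R} := @sum_sqr R k.-1.
pose E n (f : R -> R) := word_mean p n (fun w => f (pearson_word p n w)).
(* The distribution function equals a finite weighted sum over words, exactly and for every n; from
   here on the probability space is no longer involved. *)
have cdfE n : cdf (pearson_chi2 p X n : {RV P >-> R}) x =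
    (E n (fun y => (y <= x)%R%:R))%:E.
  pose b w := pearson_word p n w <= x.
  apply: (prob_word_mean p_gt0 X_indep X_multinomial (j0 := Ordinal k0) (b := b)).
    by rewrite -[X in measurable X]setTI; exact: measurable_funPT.
  move=> w z wn h; rewrite /= in_itv /=.
  by rewrite (pearson_chi2_word p wn h).
have : E n (fun y => (y <= x)%R%:R) @[n --> \oo] --> fine (cdf S x).
  apply: cdf_laplace_cvg => //.
  - by move=> z; apply: sumr_ge0 => i _; exact: sqr_ge0.
  - by move=> n a; exact: word_mean_cst.
  - by move=> n a f g; exact: word_mean_linear.
  - move=> n f g fg; apply: le_word_mean => // w _; apply: fg.
    exact: pearson_word_ge0.
  - move=> l; rewrite /Rintegral chi_square_laplace // -subn1 natrB //=.
    exact: pearson_word_laplace_cvg.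
move=> EF; under eq_cvg do rewrite cdfE.
have -> : chi_square R k.-1 `]-oo, x]%classic = (fine (cdf S x))%:E.
  by rewrite fineK // /cdf fin_num_measure.
by apply: cvg_EFin => //; exact: nearW.
Qed.
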